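(* Let $K\subset\mathbb{R}^n$ be a closed convex set with diameter $d$ and $\sigma>0$. Define $$\underline{\varepsilon}=\sup\Big\{\varepsilon>0:\ \frac{\varepsilon^2}{2\sigma}\le\frac12\sup_{\delta\le\varepsilon}\frac{\delta}{c^*}\sqrt{\log M^{\mathrm{loc}}(\delta)}\Big\},\qquad C_n=4C\big(1+\log_{c^*}\sqrt{2\pi n}\big)^{3/2},$$ where $C>1$ and $c^*$ are sufficiently large absolute constants ($c^*$ being the constant in the definition of local entropy). Then $\varepsilon_K\lesssim(4C_n\underline{\varepsilon})\wedge d$.
   Context: Gaussian sequence model: $Y=\mu+\xi$, $\mu\in K$, $\xi\sim N(0,\sigma^2\mathbb{I}_n)$; LSE $\hat\mu=\operatorname{argmin}_{\nu\in K}\|Y-\nu\|_2^2$; worst case risk $\varepsilon_K^2=\sup_{\mu\in K}\mathbb{E}_\mu\|\hat\mu-\mu\|_2^2$. $M(\eta,T)$ is the maximal cardinality of a subset of $T$ with pairwise Euclidean distances $>\eta$; local entropy $M^{\mathrm{loc}}(\varepsilon)=\sup_{\theta\in K}M(\varepsilon/c^*,B(\theta,\varepsilon)\cap K)$, $B$ the closed Euclidean ball. $\lesssim$ hides an absolute constant. *)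

(* Defs.v *)
From HB Require Import structures.
From mathcomp Require Import all_boot all_order all_algebra.
From mathcomp Require Import all_classical all_reals all_analysis.
Set Implicit Arguments. Unset Strict Implicit. Unset Printing Implicit Defensive.
Import Order.TTheory GRing.Theory Num.Theory.
Import numFieldNormedType.Exports.
Local Open Scope classical_set_scope.
Local Open Scope ring_scope.

Section Defs.
Variable R : realType.

Definition sqnorm n (v : 'rV[R]_n) : R := \sum_(i < n) (v ord0 i) ^+ 2.
Definition edist n (x y : 'rV[R]_n) : R := Num.sqrt (sqnorm (x - y)).

Definition eball n (theta : 'rV[R]_n) (r : R) : set 'rV[R]_n :=
  [set x | edist x theta <= r].

(* Diameter (possibly +oo; -oo for the empty set). *)
Definition diam n (K : set 'rV[R]_n) : \bar R :=
  ereal_sup [set (edist x y)%:E | x in K & y in K].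

Definition packing n (eta : R) (T : set 'rV[R]_n) : \bar R :=
  ereal_sup [set (size s)%:R%:E | s in
     [set s : seq 'rV[R]_n | uniq s /\ (forall x, x \in s -> T x) /\
        (forall x y, x \in s -> y \in s -> x != y -> eta < edist x y)]].

Definition Mloc n (cstar : R) (K : set 'rV[R]_n) (eps : R) : \bar R :=
  ereal_sup [set packing (eps / cstar) (eball theta eps `&` K) | theta in K].

Definition sqrt_log (x : \bar R) : \bar R :=
  match x with
  | EFin r => (if 1 <= r then Num.sqrt (ln r) else 0)%:E
  | EPInf => +oo%E
  | ENInf => 0%E
  end.

(* underline-epsilon, with the convention sup of the empty set = 0. *)
Definition eps_lower n (cstar sigma : R) (K : set 'rV[R]_n) : \bar R :=
  ereal_sup ([set 0%E] `|` [set eps%:E | eps in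
    [set eps : R | 0 < eps /\
      ((eps ^+ 2 / (2 * sigma))%:E <=
        (2^-1)%:E * ereal_sup [set ((delta / cstar)%:E * sqrt_log (Mloc cstar K delta))%E
                               | delta in [set delta : R | (0 < delta <= eps)%R]])%E]]).

Definition Cn (C cstar : R) (n : nat) : R :=
  4 * C * (1 + ln (Num.sqrt (2 * pi * n%:R)) / ln cstar) `^ (3 / 2).

(* Expectation of a nonnegative functional of xi ~ N(0, sigma^2 I_k), written
   as the iterated integral over the k independent N(0, sigma^2) coordinates
   (equal to the product-measure integral by Tonelli). *)
Fixpoint gauss_iter (sigma : R) (k : nat) (f : (nat -> R) -> \bar R) : \bar R :=
  match k with
  | 0 => f (fun _ => 0)
  | k'.+1 => (\int[normal_prob 0 sigma]_x
                gauss_iter sigma k' (fun v => f (fun i => if i is i'.+1 then v i' else x)))%E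
  end.

Definition gauss_exp n (sigma : R) (f : 'rV[R]_n -> \bar R) : \bar R :=
  gauss_iter sigma n (fun v => f (\row_(i < n) v (nat_of_ord i))).

(* Least-squares estimator: a minimiser of ||y - nu||^2 over nu in K
   (unique for nonempty closed convex K); chosen by classical choice. *)
Definition is_lse n (K : set 'rV[R]_n) (y nu : 'rV[R]_n) : Prop :=
  K nu /\ forall w, K w -> sqnorm (y - nu) <= sqnorm (y - w).

Definition lse n (K : set 'rV[R]_n) (y : 'rV[R]_n) : 'rV[R]_n :=
  xget 0 (is_lse K y).

Definition riskK n (sigma : R) (K : set 'rV[R]_n) : \bar R :=
  ereal_sup [set gauss_exp sigma (fun xi => (sqnorm (lse K (mu + xi) - mu))%:E)
            | mu in K].

End Defs.

(* Main.v *)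
(** Let [t] be the error of the LSE at [mu].  Minimality gives
    [t^2 <= 2 <xi, lse - mu>]; pulling the error back along a segment to length
    at most [eps] yields, for every [eps > 0] and some [nu] in [K] with
    [|nu - mu| <= eps], the pointwise bound
    [t^2 <= eps^2 + 4 <xi, nu - mu>^2 / eps^2].  So only the second moment of
    the local Gaussian width is needed, and no concentration inequality.

    If [eps > eps_lower], every packing of radius [delta <= eps] has at most
    [exp (b / delta^2)] points, [b = c^2 eps^4 / s^2].  Nested maximal packings
    at the scales [eps / c^k] form a tree, and a point [nu] is reached by [J]
    links and a remainder of length [eps / c^J].  By the maximal inequality each
    scale contributes at most a multiple of [J eps^4] to the second moment, so
    [J] scales give [J^3 eps^4] by Cauchy-Schwarz, whence the exponent [3/2] in
    [Cn].  The remainder is [<= |xi|^2 eps^2 / n] once [c^(2J) >= n], and its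
    expectation is of order [s^2 eps^2 <= D eps^4], because two points of [K]
    more than [eps / c] apart already force [s^2 <= D eps^2]; if there are none,
    the error is at most [eps] trivially.  Finally [eps] decreases to
    [eps_lower].

    Measurability of the LSE is never used: its squared error is dominated by a
    finite combination of exponentials of linear forms, whose Gaussian
    expectations are explicit. *)
Require Import Defs.
From HB Require Import structures.
From mathcomp Require Import all_boot all_order all_algebra.
From mathcomp Require Import all_classical all_reals all_analysis.
From mathcomp Require Import measurable_realfun.
From mathcomp Require Import ring lra.

Set Implicit Arguments. Unset Strict Implicit. Unset Printing Implicit Defensive.
Import Order.TTheory GRing.Theory Num.Theory.
Import numFieldNormedType.Exports.
Local Open Scope classical_set_scope.
Local Open Scope ring_scope.

Local Notation edist := Defs.edist.

(** * Gaussian expectations *)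

(* No measurability: the integral of a nonnegative function is a supremum over
   the simple functions below it. *)
Lemma ge0_le_integral_nomeas d (T : measurableType d) (R : realType)
    (mu : {measure set T -> \bar R}) (f g : T -> \bar R) :
  (forall x, (0 <= f x)%E) -> (forall x, (f x <= g x)%E) ->
  (\int[mu]_x f x <= \int[mu]_x g x)%E.
Proof.
move=> f0 fg.
have g0 x : (0 <= g x)%E by exact: le_trans (f0 x) (fg x).
rewrite !ge0_integralTE//; apply: le_ereal_sup => _ [h /= hf <-].
by exists h => // x; exact: le_trans (hf x) (fg x).
Qed.

(** The Radon-Nikodym derivative and the explicit density have the same integral over every
    measurable set, hence agree almost everywhere. *)
Lemma ge0_integral_normal_prob (R : realType) (m s : R) (f : R -> \bar R) :
  measurable_fun setT f -> (forall x, (0 <= f x)%E) ->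
  (\int[normal_prob m s]_x f x =
   \int[lebesgue_measure]_x (f x * (normal_pdf m s x)%:E))%E.
Proof.
move=> mf f0.
have dom := @normal_prob_dominates R m s.
rewrite -(Radon_Nikodym_SigmaFinite.change_of_variables dom)//.
have iRN := Radon_Nikodym_SigmaFinite.f_integrable dom.
have mpdf : measurable_fun setT (fun x => (normal_pdf m s x)%:E).
  by apply/measurable_EFinP; exact: measurable_normal_pdf.
apply: ae_eq_integral => //.
- by apply: emeasurable_funM => //; exact: measurable_int iRN.
- exact: emeasurable_funM.
- apply: ae_eqe_mul2l; apply: integral_ae_eq => //.
  by move=> E _ mE; rewrite -Radon_Nikodym_SigmaFinite.f_integral.
Qed.

(** Completing the square: the exponential tilt moves the mean of the density from [0] to
    [s ^+ 2 * u]. *)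
Lemma normal_prob_mgf (R : realType) (s u : R) : 0 < s ->
  (\int[normal_prob 0 s]_x (expR (u * x))%:E = (expR (s ^+ 2 * u ^+ 2 / 2))%:E)%E.
Proof.
move=> s0.
rewrite ge0_integral_normal_prob; last 2 first.
- by apply/measurable_EFinP; apply: measurableT_comp => //; exact: measurable_funM.
- by move=> x; rewrite lee_fin expR_ge0.
under eq_integral => x _.
  have -> : ((expR (u * x))%:E * (normal_pdf 0 s x)%:E =
     (expR (s ^+ 2 * u ^+ 2 / 2))%:E * (normal_pdf (s ^+ 2 * u) s x)%:E)%E.
    rewrite -!EFinM !normal_pdfE ?gt_eqF// mulrCA [in RHS]mulrCA.
    rewrite /normal_fun -!expRD; congr ((_ * expR _)%:E).
    by field; rewrite gt_eqF.
  over.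
rewrite ge0_integralZl//.
- by rewrite integral_normal_pdf mule1.
- by apply/measurable_EFinP; exact: measurable_normal_pdf.
- by move=> x _; rewrite lee_fin normal_pdf_ge0.
Qed.

Lemma gauss_iter_ge0 (R : realType) (s : R) k (f : (nat -> R) -> \bar R) :
  (forall v, (0 <= f v)%E) -> (0 <= gauss_iter s k f)%E.
Proof.
elim: k f => [|k IH] f f0 //=.
by apply: integral_ge0 => x _; exact: IH.
Qed.

(** Integrating out one coordinate keeps a combination of exponentials of linear forms in the same
    class, so the bound passes through all [k] integrals while [f] itself is only compared
    pointwise. *)
Lemma gauss_iter_le_expR_sum (R : realType) (s : R) k (I : Type) (r : seq I)
    (c : I -> R) (u : I -> nat -> R) (f : (nat -> R) -> \bar R) :
  0 < s -> (forall i, 0 <= c i) -> (forall v, (0 <= f v)%E) ->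
  (forall v, (f v <=
     (\sum_(i <- r) c i * expR (\sum_(j < k) u i j * v j))%:E)%E) ->
  (gauss_iter s k f <=
     (\sum_(i <- r) c i * expR (s ^+ 2 / 2 * \sum_(j < k) u i j ^+ 2))%:E)%E.
Proof.
move=> s0; elim: k c u f => [|k IH] c u f c0 f0 fle /=.
  apply: (le_trans (fle _)); rewrite lee_fin ler_sum// => i _.
  by rewrite !big_ord0 mulr0.
(* The coefficient left once coordinates [1] to [k] are integrated out; coordinate [0] is the
   outermost variable [x]. *)
pose C i := c i * expR (s ^+ 2 / 2 * \sum_(j < k) u i j.+1 ^+ 2).
have C0 i : 0 <= C i by rewrite mulr_ge0 ?expR_ge0.
apply: (@le_trans _ _ (\int[normal_prob 0 s]_x
    \sum_(i <- r) ((C i)%:E * (expR (u i 0 * x))%:E))%E).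
  apply: ge0_le_integral_nomeas => x; first exact: gauss_iter_ge0.
  under eq_bigr do rewrite -EFinM mulrAC.
  rewrite sumEFin; apply: (IH _ (fun i j => u i j.+1)) => // [i|v].
    by rewrite mulr_ge0 ?expR_ge0.
  apply: (le_trans (fle _)); rewrite lee_fin ler_sum// => i _.
  by rewrite big_ord_recl /= expRD mulrA.
rewrite ge0_integral_sum//; last 2 first.
- move=> i; apply: emeasurable_funM => //.
  by apply/measurable_EFinP; apply: measurableT_comp => //; exact: measurable_funM.
- by move=> i x _; rewrite -EFinM lee_fin mulr_ge0 ?expR_ge0.
rewrite -sumEFin; apply: lee_sum => i _.
rewrite ge0_integralZl ?normal_prob_mgf ?lee_fin//; last first.
  by apply/measurable_EFinP; apply: measurableT_comp => //; exact: measurable_funM.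
rewrite /C -[leLHS]mulrA -expRD big_ord_recl ler_wpM2l// ler_expR.
by rewrite mulrDr addrC mulrAC.
Qed.

Definition dotp (R : realType) n (x y : 'rV[R]_n) : R :=
  \sum_(i < n) x ord0 i * y ord0 i.

Lemma gauss_exp_le_expR_sum (R : realType) n (s : R) (I : Type) (r : seq I)
    (c : I -> R) (u : I -> 'rV[R]_n) (f : 'rV[R]_n -> \bar R) :
  0 < s -> (forall i, 0 <= c i) -> (forall v, (0 <= f v)%E) ->
  (forall v, (f v <= (\sum_(i <- r) c i * expR (dotp (u i) v))%:E)%E) ->
  (gauss_exp s f <=
     (\sum_(i <- r) c i * expR (s ^+ 2 / 2 * sqnorm (u i)))%:E)%E.
Proof.
move=> s0 c0 f0 fle; rewrite /gauss_exp.
(* Extension of the vectors by zero to all natural indices, as the iterated integral expects. *)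
pose U i j := if insub j is Some j' then u i ord0 j' else 0.
have UE i (j : 'I_n) : U i j = u i ord0 j by rewrite /U valK.
have := @gauss_iter_le_expR_sum R s n I r c U (fun v => f (\row_(i < n) v i))
  s0 c0 (fun=> f0 _).
under eq_bigr do under eq_bigr do rewrite UE.
apply=> v; apply: (le_trans (fle _)); rewrite lee_fin ler_sum// => i _.
rewrite ler_wpM2l// ler_expR /dotp.
by under eq_bigr do rewrite mxE -UE.
Qed.

(** * The least-squares estimator *)

Section Euclidean.
Variables (R : realType) (n : nat).
Implicit Types x y z mu nu xi : 'rV[R]_n.

Lemma dotpC x y : dotp x y = dotp y x.
Proof. by apply: eq_bigr => i _; rewrite mulrC. Qed.

Lemma dotpDr x y z : dotp x (y + z) = dotp x y + dotp x z.
Proof. by rewrite -big_split; apply: eq_bigr => i _; rewrite mxE mulrDr. Qed.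

Lemma dotpZr (a : R) x y : dotp x (a *: y) = a * dotp x y.
Proof. by rewrite mulr_sumr; apply: eq_bigr => i _; rewrite mxE mulrCA. Qed.

Lemma dotp_sumr (I : Type) (r : seq I) (F : I -> 'rV[R]_n) x :
  dotp x (\sum_(i <- r) F i) = \sum_(i <- r) dotp x (F i).
Proof.
elim/big_rec2: _ => [|i a b _ <-]; last exact: dotpDr.
by apply: big1 => i _; rewrite mxE mulr0.
Qed.

Lemma sqnormE x : sqnorm x = dotp x x.
Proof. by apply: eq_bigr => i _; rewrite expr2. Qed.

Lemma sqnorm_ge0 x : 0 <= sqnorm x.
Proof. by apply: sumr_ge0 => i _; rewrite sqr_ge0. Qed.

Lemma sqnorm0 : sqnorm (0 : 'rV[R]_n) = 0.
Proof. by apply: big1 => i _; rewrite mxE expr0n. Qed.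

Lemma sqnormN x : sqnorm (- x) = sqnorm x.
Proof. by apply: eq_bigr => i _; rewrite mxE sqrrN. Qed.

Lemma sqnormB x y : sqnorm (x - y) = sqnorm (y - x).
Proof. by rewrite -sqnormN opprB. Qed.

Lemma sqnormZ (a : R) x : sqnorm (a *: x) = a ^+ 2 * sqnorm x.
Proof. by rewrite mulr_sumr; apply: eq_bigr => i _; rewrite mxE exprMn. Qed.

Lemma sqnormD x y : sqnorm (x + y) = sqnorm x + 2 * dotp x y + sqnorm y.
Proof.
rewrite mulr_sumr -!big_split; apply: eq_bigr => i _ /=; rewrite mxE; ring.
Qed.

Lemma coord_sqr_le_sqnorm x i : x ord0 i ^+ 2 <= sqnorm x.
Proof.
by rewrite /sqnorm (bigD1 i)//= lerDl sumr_ge0// => j _; rewrite sqr_ge0.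
Qed.

Lemma sqnorm_eq0 x : sqnorm x = 0 -> x = 0.
Proof.
move=> x0; apply/rowP => i; rewrite mxE; apply/eqP.
by rewrite -sqrf_eq0 eq_le sqr_ge0 -x0 coord_sqr_le_sqnorm.
Qed.

(** Cauchy-Schwarz, from the nonnegative square norm of [sqnorm y *: x - dotp x y *: y]. *)
Lemma dotp_sqr_le x y : dotp x y ^+ 2 <= sqnorm x * sqnorm y.
Proof.
have [y0|y0] := eqVneq (sqnorm y) 0.
  rewrite y0 mulr0 (sqnorm_eq0 y0) -(scale0r (0 : 'rV[R]_n)) dotpZr mul0r.
  by rewrite expr0n.
have yp : 0 < sqnorm y by rewrite lt_neqAle eq_sym y0 sqnorm_ge0.
have := sqnorm_ge0 (sqnorm y *: x + (- dotp x y) *: y).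
rewrite sqnormD !sqnormZ dotpC !dotpZr dotpC dotpZr.
set A := sqnorm x; set B := sqnorm y in yp *; set D := dotp x y.
rewrite (_ : _ + _ + _ = B * (A * B - D ^+ 2)); last by ring.
by rewrite pmulr_rge0// subr_ge0.
Qed.

Lemma edist_le x y (r : R) : 0 <= r -> (edist x y <= r) = (sqnorm (x - y) <= r ^+ 2).
Proof.
by move=> r0; rewrite /edist -[r in LHS]ger0_norm// -sqrtr_sqr ler_sqrt// sqr_ge0.
Qed.

Lemma edistC x y : edist x y = edist y x.
Proof. by rewrite /edist sqnormB. Qed.

Lemma edistxx x : edist x x = 0.
Proof. by rewrite /edist subrr sqnorm0 sqrtr0. Qed.

Lemma continuous_sqnormB x : continuous (fun y : 'rV[R]_n => sqnorm (x - y)).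
Proof.
move=> y; have Fy := nbhs_filter y.
apply: cvg_big => [|i _]; first exact: add_continuous.
have cz : z ord0 i @[z --> y] --> y ord0 i by exact: coord_continuous.
have cB : (x - z) ord0 i @[z --> y] --> (x - y) ord0 i.
  under eq_fun do rewrite !mxE; rewrite !mxE.
  exact: (cvgB (cvg_cst _) cz).
exact: (cvgM cB cB).
Qed.

(** Points of [K] at least as close to [y] as a fixed [w] form a compact set, on which the distance
    attains its minimum. *)
Lemma is_lse_lse (K : set 'rV[R]_n) y : closed K -> K !=set0 -> is_lse K y (lse K y).
Proof.
move=> clK [w Kw]; rewrite /lse.
suff [v vP] : exists v, is_lse K y v by exact: (xgetI _ vP).
(* Half-side of a box containing the sublevel set: [a ^+ 2 <= m] implies that [a] lies between
   [- (m + 1)] and [m + 1]. *)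
pose r := sqnorm (y - w) + 1.
have w0 := sqnorm_ge0 (y - w).
pose A := K `&` [set x | sqnorm (y - x) <= sqnorm (y - w)].
have clA : closed A.
  apply: closedI => //.
  apply: (@preimage_closed _ _ (fun x => sqnorm (y - x)) [set t | t <= sqnorm (y - w)]).
    by move=> z _; exact: continuous_sqnormB.
  exact: closed_le.
have boxc : compact [set v : 'rV[R]_n |
    forall i, `[y ord0 i - r, y ord0 i + r]%classic (v ord0 i)].
  apply: (@rV_compact _ _ (fun i => `[y ord0 i - r, y ord0 i + r]%classic)).
  by move=> i; exact: segment_compact.
have cA : compact A.
  apply: subclosed_compact clA boxc _ => x [_ /= xw] i /=.
  have := le_trans (coord_sqr_le_sqnorm (y - x) i) xw.
  rewrite !mxE in_itv /= => h.
  rewrite /r; apply/andP; split; nra.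
have A0 : A !=set0 by exists w; split => //=.
have [|v] := @EVT_min_rV R n (fun x => sqnorm (y - x)) A A0 cA.
  by apply: continuous_subspaceT; exact: continuous_sqnormB.
rewrite inE => -[Kv vw] vmin; exists v; split => // z Kz.
have [zw|/ltW wz] := leP (sqnorm (y - z)) (sqnorm (y - w)).
  by apply: vmin; rewrite inE.
exact: le_trans wz.
Qed.

(** Take [mu] as competitor in the minimisation, expand the square and cancel [sqnorm xi]. *)
Lemma sqnorm_lse_le (K : set 'rV[R]_n) (mu xi : 'rV[R]_n) : closed K -> K mu ->
  sqnorm (lse K (mu + xi) - mu) <= 2 * dotp xi (lse K (mu + xi) - mu).
Proof.
move=> clK Kmu.
have [Kl /(_ mu Kmu)] := is_lse_lse (mu + xi) clK (ex_intro _ mu Kmu).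
set d := lse _ _ - mu.
have -> : mu + xi - lse K (mu + xi) = xi + (-1) *: d.
  by rewrite /d scaleN1r opprB addrA [xi + mu]addrC.
rewrite addrAC subrr add0r sqnormD sqnormZ dotpZr.
lra.
Qed.

Lemma convex_setP (K : set 'rV[R]_n) x y (a : R) :
  convex_set K -> K x -> K y -> 0 <= a -> a <= 1 -> K (a *: x + (1 - a) *: y).
Proof.
move=> cK Kx Ky a0 a1.
by have := cK x y (Itv01 a0 a1); rewrite !inE; apply.
Qed.

(* Segments from [mu] scale the inner product linearly: an error [d] longer than
   [eps] is pulled back to a point of [K] at distance [eps] from [mu]. *)
Lemma sqnorm_le_local_width (K : set 'rV[R]_n) mu nu xi (eps : R) :
  convex_set K -> K mu -> K nu -> 0 < eps ->
  sqnorm (nu - mu) <= 2 * dotp xi (nu - mu) ->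
  exists2 v, K v & sqnorm (v - mu) <= eps ^+ 2 /\
    sqnorm (nu - mu) <= eps ^+ 2 + 4 / eps ^+ 2 * dotp xi (v - mu) ^+ 2.
Proof.
move=> cK Kmu Knu e0; set d := nu - mu; set t2 := sqnorm d => h.
have [te|et] := leP t2 (eps ^+ 2).
  exists nu => //; split => //; rewrite (le_trans te)// lerDl.
  by rewrite mulr_ge0 ?sqr_ge0// divr_ge0 ?sqr_ge0.
pose t := Num.sqrt t2.
have tE : t2 = t ^+ 2 by rewrite sqr_sqrtr// sqnorm_ge0.
have t0 : 0 < t by rewrite sqrtr_gt0 (le_lt_trans _ et)// sqr_ge0.
have et' : eps <= t by rewrite -(@ler_pXn2r _ 2) ?nnegrE ?ltW// -tE.
pose a := eps / t.
have a0 : 0 <= a by rewrite divr_ge0 ?ltW.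
have a1 : a <= 1 by rewrite ler_pdivrMr// mul1r.
have vE : a *: nu + (1 - a) *: mu - mu = a *: d.
  by rewrite /d scalerBr scalerBl scale1r addrA addrAC addrK.
exists (a *: nu + (1 - a) *: mu); first exact: convex_setP.
rewrite vE sqnormZ dotpZr -/t2; split.
  by rewrite /a tE -exprMn divfK// gt_eqF.
(* The factor [a = eps / t] cancels [eps]; what remains is [h] divided by [t] and squared. *)
have -> : 4 / eps ^+ 2 * (a * dotp xi d) ^+ 2 = (2 * dotp xi d / t) ^+ 2.
  by rewrite /a; field; rewrite !gt_eqF.
have : t <= 2 * dotp xi d / t by rewrite ler_pdivlMr// -expr2 -tE.
rewrite -(@ler_pXn2r _ 2) ?nnegrE ?(ltW t0)//; last first.
  by rewrite divr_ge0 ?(ltW t0)// (le_trans _ h)// sqnorm_ge0.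
rewrite -tE => /le_trans; apply.
by rewrite lerDr sqr_ge0.
Qed.

End Euclidean.

(** * Chaining nets *)

Definition is_packing (R : realType) n (eta : R) (T : set 'rV[R]_n)
    (s : seq 'rV[R]_n) : Prop :=
  uniq s /\ (forall x, x \in s -> T x) /\
  (forall x y, x \in s -> y \in s -> x != y -> eta < edist x y).

(** A packing of largest size is a net: a point farther than [eta] from all its members could be
    added to it. *)
Lemma maximal_packing (R : realType) n (eta : R) (T : set 'rV[R]_n) (N : nat) :
  0 <= eta -> (forall s, is_packing eta T s -> (size s <= N)%N) ->
  exists2 s, is_packing eta T s &
    forall x, T x -> exists2 y, y \in s & edist x y <= eta.
Proof.
move=> eta0 sN.
pose P := [pred k | `[< exists2 s, is_packing eta T s & size s = k >]].
have exP : exists k, P k by exists 0; apply/asboolP; exists [::].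
have ubP k : P k -> (k <= N)%N by move=> /asboolP[s /sN + <-].
have [k /asboolP[s sP sk] kmax] := ex_maxnP exP ubP.
exists s => // x Tx; apply: contrapT => /forall2NP nx.
have far y : y \in s -> eta < edist x y.
  by move=> ys; have [//|/negP] := nx y; rewrite -ltNge.
have [us [sT ssep]] := sP.
suff : P k.+1 by move=> /kmax; rewrite ltnn.
apply/asboolP; exists (x :: s); last by rewrite /= sk.
split.
  rewrite /= us andbT; apply/negP => /far.
  by rewrite edistxx ltNge eta0.
split => [y|y z]; rewrite inE => /orP[/eqP->//|ys]; first exact: sT.
  by rewrite inE => /orP[/eqP->|zs]; [rewrite eqxx|move=> _; exact: far].
rewrite inE => /orP[/eqP->|zs]; last exact: ssep.
by move=> _; rewrite edistC; exact: far.
Qed.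

Lemma size_flatten_le (R : realType) (T1 T2 : Type) (F : T1 -> seq T2) (r : seq T1)
    (a b : R) :
  0 <= b -> (size r)%:R <= a -> (forall x, (size (F x))%:R <= b) ->
  (size (flatten [seq F x | x <- r]))%:R <= a * b.
Proof.
move=> b0 ra Fb; apply: le_trans (ler_wpM2r b0 ra).
elim: r {ra} => [|x r IH] /=; first by rewrite mul0r.
by rewrite size_cat natrD -add1n natrD mulrDl mul1r lerD.
Qed.

Section chaining.
Variables (R : realType) (n : nat) (K : set 'rV[R]_n) (mu : 'rV[R]_n).
Variables (c eps b : R).
Hypotheses (c1 : 1 <= c) (eps0 : 0 < eps) (b0 : 0 <= b) (Kmu : K mu).
Hypothesis packing_le : forall theta (delta : R) s, K theta -> 0 < delta <= eps ->
  is_packing (delta / c) (eball theta delta `&` K) s ->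
  (size s)%:R <= expR (b / delta ^+ 2).

Let delta (k : nat) := eps / c ^+ k.

Let c0 : 0 < c. Proof. exact: lt_le_trans c1. Qed.

Let delta_gt0 k : 0 < delta k.
Proof. by rewrite divr_gt0 ?exprn_gt0. Qed.

Let delta_le k : delta k <= eps.
Proof. by rewrite ler_pdivrMr ?exprn_gt0// ler_peMr ?(ltW eps0)// exprn_ege1. Qed.

Let deltaS k : delta k.+1 = delta k / c.
Proof. by rewrite /delta exprS invfM mulrA mulrAC. Qed.

Let delta_noninc k : delta k.+1 <= delta k.
Proof. by rewrite deltaS ler_pdivrMr// ler_peMr// ltW. Qed.

Let b_delta_le k : b / delta k ^+ 2 <= b / delta k.+1 ^+ 2.
Proof.
rewrite ler_wpM2l// lef_pV2 ?posrE ?exprn_gt0//.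
by rewrite ler_pXn2r ?nnegrE ?(ltW (delta_gt0 _)).
Qed.

(** The pair [p] is a centre and a level. Only covering is conditional on the centre being in [K];
    outside [K] the empty list qualifies, so choice yields a total function. *)
Let net (p : 'rV[R]_n * nat) (s : seq 'rV[R]_n) :=
  [/\ (size s)%:R <= expR (b / delta p.2 ^+ 2),
      forall y, y \in s -> K y /\ sqnorm (y - p.1) <= delta p.2 ^+ 2 &
      K p.1 -> forall x, K x -> sqnorm (x - p.1) <= delta p.2 ^+ 2 ->
        exists2 y, y \in s & sqnorm (x - y) <= delta p.2.+1 ^+ 2].

Let net_exists p : exists s, net p s.
Proof.
case: p => theta k; have [Kt|nKt] := pselect (K theta); last first.
  by exists [::]; split => //=; rewrite expR_ge0.
have dk : 0 < delta k <= eps by rewrite delta_gt0 delta_le.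
have dc0 : 0 <= delta k / c by rewrite divr_ge0 ?ltW.
have [|s sP cov] := @maximal_packing R n (delta k / c) (eball theta (delta k) `&` K)
    (Num.trunc (expR (b / delta k ^+ 2))) dc0.
  by move=> s /(packing_le Kt dk); rewrite truncn_ge_nat ?expR_ge0.
exists s; split => /=; first exact: packing_le sP.
  move=> y; case: sP => _ [sT _] /sT[yt Ky]; split => //.
  by move: yt; rewrite /eball /= edist_le// ltW.
move=> _ x Kx xt; have [|y ys xy] := cov x; last exists y => //.
  by split => //; rewrite /eball /= edist_le// ltW.
by rewrite /= deltaS -edist_le.
Qed.

Lemma chaining_nets : exists E : nat -> seq 'rV[R]_n,
  [/\ forall k, (size (E k))%:R <= expR (k.+1%:R * (b / (eps / c ^+ k) ^+ 2)),
      forall k e, e \in E k -> sqnorm e <= (eps / c ^+ k) ^+ 2 &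
      forall J nu, K nu -> sqnorm (nu - mu) <= eps ^+ 2 ->
        exists2 e : nat -> 'rV[R]_n, (forall k, (k < J)%N -> e k \in E k) &
          sqnorm (nu - mu - \sum_(k < J) e k) <= (eps / c ^+ J) ^+ 2].
Proof.
have [F FP] := choice net_exists.
(* [T k] lists the nodes of the tree at level [k], and [E k] the displacements from these nodes to
   their children. *)
pose T := fix T k := if k is k'.+1
  then flatten [seq F (theta, k') | theta <- T k'] else [:: mu].
pose E k := flatten [seq [seq y - theta | y <- F (theta, k)] | theta <- T k].
(* Each of the [k] branchings is bounded by the finest one, since [b / delta k ^+ 2] increases with
   [k]; the links of [E k] add one more branching, hence [k.+1]. *)
have sizeT k : (size (T k))%:R <= expR (k%:R * (b / delta k ^+ 2)).
  elim: k => [|k IH]; first by rewrite mul0r expR0.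
  apply: (@le_trans _ _ (expR (k.+1%:R * (b / delta k ^+ 2)))); last first.
    by rewrite ler_expR ler_wpM2l.
  rewrite -natr1 mulrDl mul1r expRD.
  by apply: size_flatten_le => // theta; case: (FP (theta, k)).
exists E; split.
- move=> k; rewrite -natr1 mulrDl mul1r expRD.
  by apply: size_flatten_le => // theta; rewrite size_map; case: (FP (theta, k)).
- move=> k e /flatten_mapP[theta _ /mapP[y ys ->]].
  by case: (FP (theta, k)) => _ /(_ _ ys)[].
have TK k theta : theta \in T k -> K theta.
  case: k => [|k]; first by rewrite inE => /eqP ->.
  by move=> /flatten_mapP[t _ ys]; case: (FP (t, k)) => _ /(_ _ ys)[].
move=> J nu Knu numu.
suff [e eE [tT ed]] : exists2 e : nat -> 'rV[R]_n,
    (forall k, (k < J)%N -> e k \in E k) &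
    mu + \sum_(k < J) e k \in T J /\
    sqnorm (nu - (mu + \sum_(k < J) e k)) <= delta J ^+ 2.
  by exists e => //; rewrite -addrA -opprD.
elim: J => [|J [e eE [tT ed]]].
  exists (fun=> 0) => //; rewrite big_ord0 addr0 inE; split => //.
  by rewrite /delta expr0 divr1.
set theta := mu + _ in tT ed.
have [_ _ cov] := FP (theta, J).
have [y ys yd] := cov (TK _ _ tT) _ Knu ed.
exists (fun k => if k == J then y - theta else e k).
  move=> k; rewrite ltnS leq_eqVlt; case: eqP => [-> _|_ /= /eE//].
  by apply/flatten_mapP; exists theta => //; apply: map_f.
rewrite big_ord_recr /= eqxx.
under eq_bigr => k _ do rewrite ltn_eqF//.
rewrite addrA addrC subrK; split => //.
by apply/flatten_mapP; exists theta.
Qed.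

End chaining.

(** * Domination by exponentials of linear forms *)

Section exp_dominated.
Variables (R : realType) (n : nat) (s : R).
Implicit Types (f g : 'rV[R]_n -> R).

(* The coefficients enter through their absolute values, so that no sign
   condition has to be carried along. *)
Definition exp_dominated f (B : R) := exists2 r : seq (R * 'rV[R]_n),
  forall v, f v <= \sum_(p <- r) `|p.1| * expR (dotp p.2 v) &
  \sum_(p <- r) `|p.1| * expR (s ^+ 2 / 2 * sqnorm p.2) <= B.

Lemma gauss_exp_le_exp_dominated f B : 0 < s -> (forall v, 0 <= f v) ->
  exp_dominated f B -> (gauss_exp s (fun v => (f v)%:E) <= B%:E)%E.
Proof.
move=> s0 f0 [r fr rB].
apply: (@le_trans _ _
  (\sum_(p <- r) `|p.1| * expR (s ^+ 2 / 2 * sqnorm p.2))%:E); last first.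
  by rewrite lee_fin.
by apply: gauss_exp_le_expR_sum => // v; rewrite lee_fin.
Qed.

Lemma exp_dominated_le f g B B' : (forall v, f v <= g v) -> B <= B' ->
  exp_dominated g B -> exp_dominated f B'.
Proof.
move=> fg BB [r gr rB]; exists r => [v|]; first exact: le_trans (gr v).
exact: le_trans BB.
Qed.

Lemma exp_dominatedD f g B B' : exp_dominated f B -> exp_dominated g B' ->
  exp_dominated (fun v => f v + g v) (B + B').
Proof.
move=> [r fr rB] [r' gr rB']; exists (r ++ r') => [v|]; rewrite big_cat; exact: lerD.
Qed.

Lemma exp_dominatedZ a f B : 0 <= a -> exp_dominated f B ->
  exp_dominated (fun v => a * f v) (a * B).
Proof.
move=> a0 [r fr rB]; exists [seq (a * p.1, p.2) | p <- r] => [v|]; rewrite big_map.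
  rewrite (eq_bigr (fun p => a * (`|p.1| * expR (dotp p.2 v)))) => [|p _].
    by rewrite -mulr_sumr ler_wpM2l.
  by rewrite /= normrM (ger0_norm a0) mulrA.
rewrite (eq_bigr (fun p => a * (`|p.1| * expR (s ^+ 2 / 2 * sqnorm p.2)))) => [|p _].
  by rewrite -mulr_sumr ler_wpM2l.
by rewrite /= normrM (ger0_norm a0) mulrA.
Qed.

Lemma exp_dominated_expR u :
  exp_dominated (fun v => expR (dotp u v)) (expR (s ^+ 2 / 2 * sqnorm u)).
Proof.
by exists [:: (1, u)] => [v|]; rewrite big_cons big_nil addr0 /= normr1 mul1r.
Qed.

Lemma exp_dominated_cst a : 0 <= a -> exp_dominated (fun=> a) a.
Proof.
move=> a0; have := exp_dominatedZ a0 (exp_dominated_expR 0).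
rewrite sqnorm0 mulr0 expR0 mulr1; apply: exp_dominated_le => // v.
have <- : 0 = dotp 0 v by rewrite dotpC -(scale0r (0 : 'rV[R]_n)) dotpZr mul0r.
by rewrite expR0 mulr1.
Qed.

Lemma exp_dominated_sum (I : eqType) (r : seq I) (F : I -> 'rV[R]_n -> R) B :
  (forall i, i \in r -> exp_dominated (F i) (B i)) ->
  exp_dominated (fun v => \sum_(i <- r) F i v) (\sum_(i <- r) B i).
Proof.
elim: r => [|i r IH] Fr.
  apply: exp_dominated_le (exp_dominated_cst (lexx 0)) => [v|];
  by rewrite big_nil.
apply: (@exp_dominated_le _ (fun v => F i v + \sum_(i <- r) F i v) (B i + \sum_(i <- r) B i)).
- by move=> v; rewrite big_cons.
- by rewrite big_cons.
apply: exp_dominatedD; first by apply: Fr; rewrite mem_head.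
by apply: IH => j jr; apply: Fr; rewrite inE jr orbT.
Qed.

Lemma sqr_le4_expR (x : R) : 0 <= x -> x ^+ 2 <= 4 * expR x.
Proof.
move=> x0; have -> : expR x = expR (x / 2) ^+ 2.
  by rewrite -expRM_natl; congr expR; field.
have := expR_ge1Dx (x / 2); set y := expR _ => h; nra.
Qed.

(** Beyond the threshold [a], one of [z - a] and [- z - a] is nonnegative, and its square is at most
    [4 / l ^+ 2] times an exponential. The factor [expR (- (l * a))] will offset the cardinality in
    the maximal inequality. *)
Lemma sqr_le_expR (z l a : R) : 0 < l ->
  z ^+ 2 <= 2 * a ^+ 2 + 8 / l ^+ 2 * expR (- (l * a)) * (expR (l * z) + expR (- (l * z))).
Proof.
move=> l0.
have E0 : 0 <= 8 / l ^+ 2 by rewrite divr_ge0 ?sqr_ge0.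
rewrite -mulrA mulrDr -!expRD.
have key y : 0 <= l * y -> y ^+ 2 <= 4 / l ^+ 2 * expR (l * y).
  move=> /sqr_le4_expR; rewrite exprMn -ler_pdivlMl ?exprn_gt0// => /le_trans; apply.
  by rewrite mulrA [_^-1 * 4]mulrC.
have [zl|zl] := leP (`|z|) `|a|.
  have : z ^+ 2 <= a ^+ 2.
    rewrite -real_normK ?num_real// -[leRHS]real_normK ?num_real//.
    by rewrite ler_pXn2r ?nnegrE.
  move=> za; rewrite (le_trans za)// -[leLHS]addr0 lerD//.
    by have := sqr_ge0 a; lra.
  by rewrite mulr_ge0// addr_ge0 ?expR_ge0.
have {zl} : 0 <= z - a \/ 0 <= - z - a.
  by have := ler_norm a; case: (ger0P z) zl => _ za; [left|right]; lra.
move=> [za|za].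
- have := key _ (mulr_ge0 (ltW l0) za).
  rewrite mulrBr [l * z - l * a]addrC; set x := expR (- (l * a) + l * z).
  have := expR_ge0 (- (l * a) + - (l * z)); set y := expR _ => y0 h.
  have : z ^+ 2 <= 2 * a ^+ 2 + 2 * (z - a) ^+ 2.
    by have := sqr_ge0 (z - 2 * a); nra.
  move=> /le_trans; apply; rewrite lerD2l mulrDr.
  have : 0 <= 8 / l ^+ 2 * y by rewrite mulr_ge0.
  have -> : 8 / l ^+ 2 * x = 2 * (4 / l ^+ 2 * x) by ring.
  lra.
- have := key _ (mulr_ge0 (ltW l0) za).
  rewrite mulrBr mulrN [- (l * z) - l * a]addrC; set x := expR (- (l * a) + - (l * z)).
  have := expR_ge0 (- (l * a) + l * z); set y := expR _ => y0 h.
  have : z ^+ 2 <= 2 * a ^+ 2 + 2 * (- z - a) ^+ 2.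
    by have := sqr_ge0 (z + 2 * a); nra.
  move=> /le_trans; apply; rewrite lerD2l mulrDr.
  have : 0 <= 8 / l ^+ 2 * y by rewrite mulr_ge0.
  have -> : 8 / l ^+ 2 * x = 2 * (4 / l ^+ 2 * x) by ring.
  lra.
Qed.

Hypothesis s0 : 0 < s.

(* [q] bounds twice the log-cardinality of [E]; [l] balances the two terms of
   [sqr_le_expR]. *)
Lemma exp_dominated_max (E : seq 'rV[R]_n) (d q : R) : 0 < d -> 1 <= q ->
  (size E)%:R <= expR (q / 2) -> (forall e, e \in E -> sqnorm e <= d ^+ 2) ->
  exists2 g, forall v e, e \in E -> dotp v e ^+ 2 <= g v &
    exp_dominated g (18 * (q * s ^+ 2 * d ^+ 2)).
Proof.
move=> d0 q1 sizeE normE.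
have q0 : 0 < q by exact: lt_le_trans q1.
pose w := Num.sqrt q.
have w2 : w ^+ 2 = q by rewrite sqr_sqrtr ?ltW.
have w0 : 0 < w by rewrite sqrtr_gt0.
(* Each exponential moment at [l] is at most [expR (q / 2)], and so is the number of points; their
   product is cancelled by [expR (- (l * a)) = expR (- q)]. *)
pose l := w / (s * d); pose a := w * (s * d).
have l0 : 0 < l by rewrite divr_gt0 ?mulr_gt0.
have la : l * a = q by rewrite -w2 /l /a; field; rewrite !gt_eqF.
pose C := 8 / l ^+ 2 * expR (- q).
have C0 : 0 <= C by rewrite mulr_ge0 ?expR_ge0// divr_ge0 ?sqr_ge0.
have lsd : s ^+ 2 / 2 * (l ^+ 2 * d ^+ 2) = q / 2.
  by rewrite -w2 /l; field; rewrite !gt_eqF.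
exists (fun v => 2 * a ^+ 2 +
    C * \sum_(e <- E) (expR (dotp (l *: e) v) + expR (dotp ((- l) *: e) v))).
  move=> v e eE; apply: le_trans (sqr_le_expR (dotp v e) a l0) _.
  rewrite la lerD2l ler_wpM2l// (big_rem e eE)/= -[leLHS]addr0.
  rewrite ![dotp (_ *: _) v]dotpC !dotpZr mulNr lerD//.
  by apply: sumr_ge0 => ? _; rewrite addr_ge0 ?expR_ge0.
have step e : e \in E ->
    exp_dominated (fun v => expR (dotp (l *: e) v) + expR (dotp ((- l) *: e) v))
      (2 * expR (q / 2)).
  move=> eE; apply: exp_dominated_le (exp_dominatedD (exp_dominated_expR _)
    (exp_dominated_expR _)) => //.
  rewrite !sqnormZ sqrrN.
  suff : expR (s ^+ 2 / 2 * (l ^+ 2 * sqnorm e)) <= expR (q / 2) by lra.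
  rewrite ler_expR -lsd ler_wpM2l ?divr_ge0 ?sqr_ge0//.
  by rewrite ler_wpM2l ?sqr_ge0// normE.
have a20 : 0 <= 2 * a ^+ 2 by rewrite mulr_ge0 ?sqr_ge0.
apply: exp_dominated_le (exp_dominatedD (exp_dominated_cst a20)
  (exp_dominatedZ C0 (exp_dominated_sum step))) => //.
rewrite big_const_seq count_predT iter_addr addr0 -[_ *+ size E]mulr_natr.
have a2 : a ^+ 2 = q * s ^+ 2 * d ^+ 2 by rewrite /a !exprMn w2 mulrA.
have Cle : C * (2 * expR (q / 2) * (size E)%:R) <= 16 / l ^+ 2.
  apply: (@le_trans _ _ (C * (2 * expR (q / 2) * expR (q / 2)))).
    by rewrite !ler_wpM2l// mulr_ge0 ?expR_ge0.
  rewrite /C -[2 * _ * _]mulrA -expRD -mulrA [expR (- q) * _]mulrCA -expRD.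
  rewrite (_ : - q + _ = 0) ?expR0; last by field.
  by rewrite mulr1 mulrAC -natrM.
(* Here [1 <= q] enters. The constant [18] is this [16] plus the [2] of [2 * a ^+ 2]. *)
have : 16 / l ^+ 2 <= 16 * (q * s ^+ 2 * d ^+ 2).
  have -> : 16 / l ^+ 2 = 16 * (s ^+ 2 * d ^+ 2 / q).
    by rewrite -w2 /l; field; rewrite !gt_eqF.
  rewrite ler_pM2l// -[q * _ * _]mulrA; set X := s ^+ 2 * d ^+ 2.
  have X0 : 0 <= X by rewrite mulr_ge0 ?sqr_ge0.
  have qX : X <= q * X by rewrite ler_peMl.
  by rewrite ler_pdivrMr// (le_trans qX)// ler_peMr// mulr_ge0// ltW.
rewrite a2; lra.
Qed.

(** Coordinatewise use of [sqr_le_expR] with threshold [0] and [l = s^-1], for which each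
    exponential has moment [expR (2^-1)]. *)
Lemma exp_dominated_sqnorm :
  exp_dominated (@sqnorm R n) (16 * expR (2^-1) * n%:R * s ^+ 2).
Proof.
pose dl (i : 'I_n) : 'rV[R]_n := s^-1 *: delta_mx ord0 i.
have dotp_delta (i : 'I_n) v : dotp (delta_mx ord0 i) v = v ord0 i.
  rewrite /dotp (bigD1 i)//= mxE !eqxx mul1r big1 ?addr0// => j ji.
  by rewrite mxE (negbTE ji) andbF mul0r.
have sqd (i : 'I_n) : sqnorm (delta_mx ord0 i : 'rV[R]_n) = 1.
  by rewrite sqnormE dotp_delta mxE !eqxx.
have step i : exp_dominated (fun v : 'rV[R]_n => v ord0 i ^+ 2)
    (8 * s ^+ 2 * (expR (2^-1) + expR (2^-1))).
  have c0 : 0 <= 8 * s ^+ 2 by rewrite mulr_ge0 ?sqr_ge0.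
  apply: exp_dominated_le (exp_dominatedZ c0 (exp_dominatedD
    (exp_dominated_expR (dl i)) (exp_dominated_expR (- dl i)))).
    move=> v; have sV : 0 < s^-1 by rewrite invr_gt0.
    have := sqr_le_expR (v ord0 i) 0 sV.
    rewrite mulr0 oppr0 expR0 mulr1 expr0n mulr0 add0r exprVn invrK.
    have -> : dotp (dl i) v = s^-1 * v ord0 i.
      by rewrite dotpC dotpZr dotpC dotp_delta.
    have -> // : dotp (- dl i) v = - (s^-1 * v ord0 i).
    by rewrite dotpC -scaleN1r scalerA dotpZr dotpC dotp_delta mulN1r mulNr.
  rewrite sqnormN sqnormZ sqd mulr1 ler_wpM2l//.
  have -> // : s ^+ 2 / 2 * s^-1 ^+ 2 = 2^-1 by field; rewrite gt_eqF.
apply: exp_dominated_le (exp_dominated_sum (r := index_enum _) (fun i _ => step i)) => //.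
rewrite big_const_seq count_predT iter_addr addr0 -[_ *+ _]mulr_natr.
have -> : size (index_enum 'I_n) = n by rewrite -[RHS]card_ord cardT enumT.
rewrite le_eqVlt; apply/orP; left; apply/eqP; ring.
Qed.

End exp_dominated.

(** * Risk of the estimator *)

Lemma sqr_sum_le (R : realType) m (x : 'I_m -> R) :
  (\sum_i x i) ^+ 2 <= m%:R * \sum_i x i ^+ 2.
Proof.
have := dotp_sqr_le (const_mx 1) (\row_i x i).
rewrite /dotp /sqnorm; under eq_bigr do rewrite !mxE mul1r.
under [in leRHS]eq_bigr do rewrite mxE expr1n.
under [X in _ * X]eq_bigr do rewrite mxE.
by rewrite sumr_const card_ord.
Qed.

(** The three factors [J] come from Cauchy-Schwarz over the scales, from summing over them, and from
    the factor [k.+1] in the log-cardinality of the links. *)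
Lemma lse_risk_le_chaining (R : realType) n (K : set 'rV[R]_n) mu (s c eps D : R) J :
  closed K -> convex_set K -> K mu -> 0 < s -> 1 <= c -> 0 < eps -> (0 < J)%N ->
  n%:R <= (c ^+ J) ^+ 2 -> s ^+ 2 <= D * eps ^+ 2 ->
  (forall theta (delta : R) r, K theta -> 0 < delta <= eps ->
    is_packing (delta / c) (eball theta delta `&` K) r ->
    (size r)%:R <= expR (c ^+ 2 * eps ^+ 4 / s ^+ 2 / delta ^+ 2)) ->
  (gauss_exp s (fun xi => (sqnorm (lse K (mu + xi) - mu))%:E) <=
   ((1 + 144 * (D + 2 * c ^+ 2) + 128 * expR (2^-1) * D) * J%:R ^+ 3 * eps ^+ 2)%:E)%E.
Proof.
move=> clK cK Kmu s0 c1 e0 J0 nJ sD packing_le.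
have c0 : 0 < c by exact: lt_le_trans c1.
set b := c ^+ 2 * eps ^+ 4 / s ^+ 2 in packing_le.
have b0 : 0 <= b by rewrite divr_ge0 ?mulr_ge0 ?exprn_ge0 ?ltW.
have bs : b * s ^+ 2 = c ^+ 2 * eps ^+ 4 by rewrite /b divfK// gt_eqF ?exprn_gt0.
have D0 : 0 <= D.
  by rewrite -(pmulr_lge0 _ (exprn_gt0 2 e0)) (le_trans _ sD) ?sqr_ge0.
have [E [sizeE normE chainE]] := chaining_nets c1 e0 b0 Kmu packing_le.
pose delta k := eps / c ^+ k.
have d0 k : 0 < delta k by rewrite divr_gt0 ?exprn_gt0.
have de k : delta k <= eps.
  by rewrite ler_pdivrMr ?exprn_gt0// ler_peMr ?(ltW e0)// exprn_ege1.
(* Twice the log-cardinality bound of [E k], raised by [1] to meet [1 <= q] in the maximal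
   inequality. *)
pose q k := 1 + 2 * (k.+1%:R * (b / delta k ^+ 2)).
have bd k : 0 <= k.+1%:R * (b / delta k ^+ 2).
  by rewrite mulr_ge0// divr_ge0// sqr_ge0.
have q1 k : 1 <= q k by rewrite lerDl mulr_ge0.
have sizeq k : (size (E k))%:R <= expR (q k / 2).
  apply: (le_trans (sizeE k)); rewrite ler_expR /q -/(delta k).
  by have := bd k; lra.
have /choice[g gP] k : exists h : 'rV[R]_n -> R,
    (forall v e, e \in E k -> dotp v e ^+ 2 <= h v) /\
    exp_dominated s h (18 * (q k * s ^+ 2 * delta k ^+ 2)).
  have [h hE hdom] := exp_dominated_max s0 (d0 k) (q1 k) (sizeq k) (normE k).
  by exists h.
have coef0 : 0 <= 8 / eps ^+ 2 by rewrite divr_ge0 ?sqr_ge0.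
(* The [8] is the [4] of [sqnorm_le_local_width] doubled by splitting the square of links plus
   remainder. *)
have domF : exp_dominated s (fun v => eps ^+ 2 + 8 / eps ^+ 2 *
    (J%:R * \sum_(k < J) g k v + delta J ^+ 2 * sqnorm v))
    (eps ^+ 2 + 8 / eps ^+ 2 *
    (J%:R * \sum_(k < J) 18 * (q k * s ^+ 2 * delta k ^+ 2) +
     delta J ^+ 2 * (16 * expR (2^-1) * n%:R * s ^+ 2))).
  apply: exp_dominatedD; first by apply: exp_dominated_cst; exact: sqr_ge0.
  apply: exp_dominatedZ => //; apply: exp_dominatedD.
    apply: exp_dominatedZ => //.
    by apply: (@exp_dominated_sum _ _ _ 'I_J) => k _; case: (gP k).
  by apply: exp_dominatedZ; [exact: sqr_ge0|exact: exp_dominated_sqnorm].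
apply: gauss_exp_le_exp_dominated => //; first by move=> v; exact: sqnorm_ge0.
apply: exp_dominated_le domF.
  move=> xi.
  have Kl : K (lse K (mu + xi)).
    by case: (is_lse_lse (mu + xi) clK (ex_intro _ mu Kmu)).
  have [nu Knu [numu lse_le]] :=
    sqnorm_le_local_width cK Kmu Kl e0 (sqnorm_lse_le xi clK Kmu).
  apply: (le_trans lse_le); rewrite lerD2l.
  have -> : 8 / eps ^+ 2 = 4 / eps ^+ 2 * 2 by rewrite mulrAC -natrM.
  rewrite -[leRHS]mulrA ler_wpM2l ?divr_ge0 ?sqr_ge0//.
  have [e eE] := chainE J nu Knu numu.
  set rho := nu - mu - _ => rhoJ.
  have -> : nu - mu = \sum_(k < J) e k + rho by rewrite [RHS]addrC subrK.
  rewrite dotpDr dotp_sumr; set A := \sum_(k < J) _; set r := dotp _ rho.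
  have A2 : A ^+ 2 <= J%:R * \sum_(k < J) g k xi.
    apply: (le_trans (sqr_sum_le _)); rewrite ler_wpM2l// ler_sum// => k _.
    by case: (gP k) => + _; apply; exact: eE.
  have r2 : r ^+ 2 <= delta J ^+ 2 * sqnorm xi.
    apply: (le_trans (dotp_sqr_le _ _)); rewrite mulrC ler_wpM2r ?sqnorm_ge0//.
  have := sqr_ge0 (A - r); nra.
have J1 : 1 <= J%:R :> R by rewrite ler1n.
have sumle : \sum_(k < J) 18 * (q k * s ^+ 2 * delta k ^+ 2) <=
    J%:R * (18 * (J%:R * ((D + 2 * c ^+ 2) * eps ^+ 4))).
  apply: (@le_trans _ _ (\sum_(k < J) 18 * (J%:R * ((D + 2 * c ^+ 2) * eps ^+ 4)))).
    apply: ler_sum => k _; rewrite ler_pM2l//.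
    (* The scale [delta k] cancels against the entropy [b / delta k ^+ 2], so fine scales cost no
       more than a multiple of [J%:R * eps ^+ 4]. *)
    have -> : q k * s ^+ 2 * delta k ^+ 2 =
        s ^+ 2 * delta k ^+ 2 + 2 * (k.+1%:R * (c ^+ 2 * eps ^+ 4)).
      by rewrite -bs /q; field; rewrite gt_eqF.
    have sde : s ^+ 2 * delta k ^+ 2 <= D * eps ^+ 4.
      rewrite (exprD eps 2 2) mulrA ler_pM ?sqr_ge0//.
      by rewrite ler_pXn2r ?nnegrE ?de ?(ltW e0)// ltW.
    have kJ : k.+1%:R <= J%:R :> R by rewrite ler_nat.
    have c4 : 0 <= c ^+ 2 * eps ^+ 4 by rewrite mulr_ge0 ?exprn_ge0 ?ltW.
    have kc := ler_wpM2r c4 kJ.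
    have D4 : 0 <= D * eps ^+ 4 by rewrite mulr_ge0// exprn_ge0// ltW.
    have JD : D * eps ^+ 4 <= J%:R * (D * eps ^+ 4) by rewrite ler_peMl.
    move: sde kc JD; set x := D * _; set y := c ^+ 2 * _ => sde kc JD.
    have -> : J%:R * ((D + 2 * c ^+ 2) * eps ^+ 4) = J%:R * x + 2 * (J%:R * y).
      by rewrite /x /y; ring.
    lra.
  by rewrite sumr_const card_ord -[leLHS]mulr_natl.
have tail : delta J ^+ 2 * (16 * expR (2^-1) * n%:R * s ^+ 2) <=
    16 * expR (2^-1) * (D * eps ^+ 4).
  have h : delta J ^+ 2 * n%:R <= eps ^+ 2.
    by rewrite /delta expr_div_n mulrAC ler_pdivrMr ?exprn_gt0// ler_wpM2l ?sqr_ge0.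
  have := ler_pM (mulr_ge0 (sqr_ge0 _) (ler0n _ _)) (sqr_ge0 _) h sD.
  have -> : delta J ^+ 2 * (16 * expR (2^-1) * n%:R * s ^+ 2) =
    16 * expR (2^-1) * (delta J ^+ 2 * n%:R * s ^+ 2) by ring.
  have -> : eps ^+ 2 * (D * eps ^+ 2) = D * eps ^+ 4 by ring.
  by move=> ?; rewrite ler_wpM2l// mulr_ge0 ?expR_ge0.
have := ler_wpM2l (ler0n R J) sumle.
set S := J%:R * \sum_(k < J) _; set T := delta J ^+ 2 * _ in tail *.
move=> SJ; have ST := ler_wpM2l coef0 (lerD SJ tail).
rewrite -/S -/T; apply: (le_trans (lerD (lexx (eps ^+ 2)) ST)).
have J3 : 1 <= J%:R ^+ 3 :> R by rewrite exprn_ege1.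
have := expR_gt0 (2^-1 : R); set h := expR _ => h0.
have -> : eps ^+ 2 + 8 / eps ^+ 2 *
    (J%:R * (J%:R * (18 * (J%:R * ((D + 2 * c ^+ 2) * eps ^+ 4)))) +
    16 * h * (D * eps ^+ 4)) =
  (144 * (D + 2 * c ^+ 2)) * J%:R ^+ 3 * eps ^+ 2 + (1 + 128 * h * D) * eps ^+ 2.
  by field; rewrite gt_eqF.
rewrite -mulrDl ler_wpM2r ?sqr_ge0//.
have : 1 + 128 * h * D <= (1 + 128 * h * D) * J%:R ^+ 3.
  by rewrite ler_peMr// addr_ge0// mulr_ge0// mulr_ge0// ltW.
lra.
Qed.

(** * Local entropy above the critical radius *)

(** Above the supremum the defining inequality fails at [eps], so every term with [delta <= eps] is
    below [eps ^+ 2 / (2 * s)]; solve this for the entropy. *)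
Lemma packing_le_gt_eps_lower (R : realType) n (K : set 'rV[R]_n) (c s eps : R) :
  0 < s -> 0 < c -> 0 < eps -> (eps_lower c s K < eps%:E)%E ->
  forall theta (delta : R) r, K theta -> 0 < delta <= eps ->
    is_packing (delta / c) (eball theta delta `&` K) r ->
    (size r)%:R <= expR (c ^+ 2 * eps ^+ 4 / s ^+ 2 / delta ^+ 2).
Proof.
move=> s0 c0 e0 elt theta delta r Kt /andP[d0 de] rP.
have sizeM : ((size r)%:R%:E <= Mloc c K delta)%E.
  apply: (@le_trans _ _ (packing (delta / c) (eball theta delta `&` K))).
    by apply: ereal_sup_ubound; exists r.
  by apply: ereal_sup_ubound; exists theta.
have TS : (2^-1%:E * ((delta / c)%:E * sqrt_log (Mloc c K delta)) <
    (eps ^+ 2 / (2 * s))%:E)%E.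
  rewrite ltNge; apply/negP => h; move: elt; rewrite ltNge => /negP; apply.
  apply: ereal_sup_ubound; right; exists eps => //; split => //.
  apply: (le_trans h); apply: lee_wpmul2l; first by rewrite lee_fin.
  by apply: ereal_sup_ubound; exists delta => //=; rewrite d0.
move: sizeM TS; case: (Mloc c K delta) => [m| |] //=; last first.
  (* An infinite local entropy contradicts the strict upper bound. *)
  by rewrite gt0_muley ?lte_fin ?divr_gt0// gt0_muley ?lte_fin ?invr_gt0.
rewrite lee_fin => sizem; case: (leP 1 m) => [m1|m1 _]; last first.
  rewrite (le_trans sizem)// (le_trans (ltW m1))// -expR0 ler_expR.
  by rewrite !divr_ge0 ?mulr_ge0 ?exprn_ge0 ?ltW.
rewrite -!EFinM lte_fin => h; apply: (le_trans sizem).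
have m0 : 0 < m by exact: lt_le_trans m1.
rewrite -[m]lnK ?posrE// ler_expR.
have -> : c ^+ 2 * eps ^+ 4 / s ^+ 2 / delta ^+ 2 = (c * eps ^+ 2 / s / delta) ^+ 2.
  by field; rewrite !gt_eqF.
have key : Num.sqrt (ln m) <= c * eps ^+ 2 / s / delta.
  rewrite ler_pdivlMr// ler_pdivlMr//.
  move: h; rewrite ltr_pdivlMr ?mulr_gt0// => /ltW.
  have -> : 2^-1 * (delta / c * Num.sqrt (ln m)) * (2 * s) =
      Num.sqrt (ln m) * delta * s / c by field; rewrite gt_eqF.
  by rewrite ler_pdivrMr// [_ * c]mulrC.
by rewrite -[leLHS]sqr_sqrtr ?ln_ge0// ler_pXn2r ?nnegrE// (le_trans _ key).
Qed.

(** By convexity some [z] in [K] is at distance between [eps / c] and [eps] from [x]. The two-point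
    packing of [z] and [x] at radius [eps] gives [2 <= expR (c ^+ 2 * eps ^+ 2 / s ^+ 2)]. *)
Lemma noise_le_gt_eps_lower (R : realType) n (K : set 'rV[R]_n) (c s eps : R) x y :
  convex_set K -> 0 < s -> 1 < c -> 0 < eps -> (eps_lower c s K < eps%:E)%E ->
  K x -> K y -> eps / c < edist x y -> s ^+ 2 <= c ^+ 2 / ln 2 * eps ^+ 2.
Proof.
move=> cK s0 c1 e0 elt Kx Ky xy.
have c0 : 0 < c by exact: lt_trans c1.
have ec : eps / c < eps by rewrite ltr_pdivrMr// ltr_pMr.
have ec0 : 0 < eps / c by rewrite divr_gt0.
have [z Kz /andP[zx xz]] : exists2 z, K z & eps / c < edist z x <= eps.
  have [xye|xye] := leP (edist x y) eps; first by exists y => //; rewrite edistC xy.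
  have t0 : 0 < edist x y by exact: lt_trans xye.
  exists (eps / edist x y *: y + (1 - eps / edist x y) *: x).
    by apply: convex_setP => //; rewrite ?divr_ge0 ?ltW// ltr_pdivrMr// mul1r.
  have zE : eps / edist x y *: y + (1 - eps / edist x y) *: x - x =
      (eps / edist x y) *: (y - x).
    by rewrite scalerBr scalerBl scale1r addrA addrAC addrK.
  suff -> : edist (eps / edist x y *: y + (1 - eps / edist x y) *: x) x = eps.
    by rewrite ec lexx.
  rewrite /Defs.edist zE sqnormZ sqrtrM ?sqr_ge0// sqrtr_sqr -sqnormB -/(edist x y).
  by rewrite ger0_norm ?divr_ge0 ?ltW// divfK// gt_eqF.
have e01 : 0 < eps <= eps by rewrite e0 lexx.
have two := packing_le_gt_eps_lower s0 c0 e0 elt Kx e01 (r := [:: z; x]).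
have zNx : z != x by apply: contraTneq zx => ->; rewrite edistxx -leNgt ltW.
have {two} : 2 <= expR (c ^+ 2 * eps ^+ 4 / s ^+ 2 / eps ^+ 2).
  apply: two; split; first by rewrite /= inE zNx.
  split => [w|u v]; rewrite !inE => /orP[]/eqP->.
  - by split.
  - by split => //; rewrite /eball /= edistxx ltW.
  - by move=> /orP[]/eqP->; rewrite ?eqxx.
  - by move=> /orP[]/eqP->; rewrite ?eqxx// edistC.
rewrite -[leLHS]lnK ?posrE// ler_expR.
have ln2 : 0 < ln (2 : R) by rewrite ln_gt0// ltr1n.
have -> : c ^+ 2 * eps ^+ 4 / s ^+ 2 / eps ^+ 2 = c ^+ 2 * eps ^+ 2 / s ^+ 2.
  by field; rewrite !gt_eqF.
rewrite ler_pdivlMr ?exprn_gt0// -ler_pdivlMl// => /le_trans; apply.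
by rewrite mulrA [_^-1 * _]mulrC.
Qed.

(** * Length of the chain and assembly of the final bound *)

(** [J] is one more than the integer part of the base-[c] logarithm of the square root of [n]; the
    upper bound follows from [n <= 2 * pi * n]. *)
Lemma exists_chain_length (R : realType) n (c : R) : 1 < c -> (0 < n)%N ->
  exists J, [/\ (0 < J)%N, n%:R <= (c ^+ J) ^+ 2 &
    J%:R <= 1 + ln (Num.sqrt (2 * pi * n%:R)) / ln c].
Proof.
move=> c1 n0; have c0 : 0 < c by exact: lt_trans c1.
have lnc : 0 < ln c by rewrite ln_gt0.
have n1 : 1 <= n%:R :> R by rewrite ler1n.
have sq1 : 1 <= Num.sqrt (n%:R : R) by rewrite -[leLHS]sqrtr1 ler_sqrt.
have x0 : 0 <= ln (Num.sqrt (n%:R : R)) / ln c by rewrite divr_ge0 ?ln_ge0// ltW.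
exists (Num.trunc (ln (Num.sqrt (n%:R : R)) / ln c)).+1; split => //.
- rewrite -[leLHS](sqr_sqrtr (ler0n _ n)) ler_pXn2r ?nnegrE ?exprn_ge0 ?(ltW c0)//.
  rewrite -[leLHS]lnK ?posrE ?(lt_le_trans _ sq1)// -[c in leRHS]lnK ?posrE//.
  rewrite -expRM_natl ler_expR -ler_pdivrMr//.
  by rewrite lnK ?posrE//; apply: ltW; exact: truncnS_gt.
- have /andP[+ _] := truncn_itv x0.
  rewrite -natr1 addrC lerD2l => /le_trans; apply; rewrite ler_pM2r ?invr_gt0//.
  rewrite ler_ln ?posrE ?sqrtr_gt0 ?mulr_gt0 ?pi_gt0 ?(lt_le_trans _ n1)//.
  rewrite ler_sqrt ?mulr_ge0 ?pi_ge0//.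
  rewrite ler_peMl//; have := @pi_ge2 R; lra.
Qed.

Lemma lee_sqr_right (R : realType) (X : \bar R) (a e : R) : 0 <= a -> 0 <= e ->
  (forall h, e < h -> (X <= (a * h ^+ 2)%:E)%E) -> (X <= (a * e ^+ 2)%:E)%E.
Proof.
move=> a0 e0 Xh; apply/lee_addgt0Pr => g g0.
(* For [h <= 1] the increment of [a * e ^+ 2] is at most [a * (2 * e + 1) * h]; adding [g] makes [m]
   positive and [g / m <= 1]. *)
pose m := a * (2 * e + 1) + g.
have m0 : 0 < m by rewrite ltr_wpDl// mulr_ge0// addr_ge0// mulr_ge0.
pose h := g / m.
have h0 : 0 < h by rewrite divr_gt0.
have h1 : h <= 1 by rewrite ler_pdivrMr// mul1r lerDr mulr_ge0// addr_ge0// mulr_ge0.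
have hm : h * m = g by rewrite divfK// gt_eqF.
apply: (le_trans (Xh (e + h) _)); first by rewrite ltrDl.
rewrite -EFinD lee_fin -hm /m.
have : a * (h * h) <= a * h by rewrite ler_wpM2l// ler_piMl// ltW.
have : 0 <= h * g by rewrite mulr_ge0 ?ltW.
nra.
Qed.

Lemma gauss_exp_le_cst (R : realType) n (s a : R) (f : 'rV[R]_n -> R) :
  0 < s -> (forall v, 0 <= f v) -> (forall v, f v <= a) ->
  (gauss_exp s (fun v => (f v)%:E) <= a%:E)%E.
Proof.
move=> s0 f0 fa; apply: gauss_exp_le_exp_dominated => //.
have a0 : 0 <= a by exact: le_trans (f0 0) (fa 0).
exact: (exp_dominated_le fa (lexx a) (exp_dominated_cst _ _ a0)).
Qed.

(** The constant of [lse_risk_le_chaining] at [D = c ^+ 2 / ln 2], the value supplied by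
    [noise_le_gt_eps_lower]. *)
Definition risk_cst (R : realType) (c : R) : R :=
  1 + 144 * (c ^+ 2 / ln 2 + 2 * c ^+ 2) + 128 * expR (2^-1) * (c ^+ 2 / ln 2).

Lemma risk_cst_ge1 (R : realType) (c : R) : 1 <= risk_cst c.
Proof.
have ln2 : 0 <= ln (2 : R) by rewrite ln_ge0// ler1n.
have c2 : 0 <= c ^+ 2 / ln 2 by rewrite divr_ge0// sqr_ge0.
rewrite /risk_cst -addrA lerDl addr_ge0// mulr_ge0 ?addr_ge0//.
by rewrite mulr_ge0// sqr_ge0.
Qed.

Lemma lse_risk_le_gt_eps_lower (R : realType) n (K : set 'rV[R]_n) mu (s c eps : R) :
  closed K -> convex_set K -> K mu -> 0 < s -> 1 < c -> (0 < n)%N -> 0 < eps ->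
  (eps_lower c s K < eps%:E)%E ->
  (gauss_exp s (fun xi => (sqnorm (lse K (mu + xi) - mu))%:E) <=
   (risk_cst c * (1 + ln (Num.sqrt (2 * pi * n%:R)) / ln c) ^+ 3 * eps ^+ 2)%:E)%E.
Proof.
move=> clK cK Kmu s0 c1 n0 e0 elt.
have [J [J0 nJ JL]] := exists_chain_length c1 n0.
have J1 : 1 <= J%:R :> R by rewrite ler1n.
set L := 1 + _ in JL *.
have A1 := risk_cst_ge1 c; have A0 : 0 <= risk_cst c by exact: le_trans A1.
have JL3 : J%:R ^+ 3 <= L ^+ 3.
  by rewrite ler_pXn2r ?nnegrE// (le_trans _ JL).
have [[x [y [Kx Ky xy]]]|small] :=
    pselect (exists x y, [/\ K x, K y & eps / c < edist x y]).
  have sD := noise_le_gt_eps_lower cK s0 c1 e0 elt Kx Ky xy.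
  have c0 : 0 < c by exact: lt_trans c1.
  apply: le_trans (lse_risk_le_chaining clK cK Kmu s0 (ltW c1) e0 J0 nJ sD _) _.
    exact: packing_le_gt_eps_lower.
  by rewrite lee_fin ler_wpM2r ?sqr_ge0// ler_wpM2l.
apply: (@le_trans _ _ (eps ^+ 2)%:E).
  apply: gauss_exp_le_cst => // v; first exact: sqnorm_ge0.
  have Kl : K (lse K (mu + v)) by case: (is_lse_lse (mu + v) clK (ex_intro _ mu Kmu)).
  rewrite -edist_le ?(ltW e0)// (@le_trans _ _ (eps / c))//.
    by rewrite leNgt; apply/negP => h; apply: small; exists (lse K (mu + v)), mu.
  by rewrite ler_pdivrMr ?(lt_trans _ c1)// ler_peMr// ltW.
rewrite lee_fin ler_peMl ?sqr_ge0// mulr_ege1//.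
by apply: (le_trans _ JL3); rewrite exprn_ege1.
Qed.

(** Squaring turns the real exponent [3 / 2] into the cube that appears in the risk bound. *)
Lemma sqr_Cn (R : realType) (C c : R) n : 0 <= 1 + ln (Num.sqrt (2 * pi * n%:R)) / ln c ->
  Cn C c n ^+ 2 = 16 * C ^+ 2 * (1 + ln (Num.sqrt (2 * pi * n%:R)) / ln c) ^+ 3.
Proof.
move=> L0; rewrite /Cn exprMn exprMn -natrX; congr (_ * _).
rewrite -[LHS]powR_mulrn ?powR_ge0// -[LHS]powRrM -[RHS]powR_mulrn//.
by congr (_ `^ _); field.
Qed.

Lemma eps_lower_ge0 (R : realType) n (K : set 'rV[R]_n) (c s : R) :
  (0 <= eps_lower c s K)%E.
Proof. by apply: ereal_sup_ubound; left. Qed.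

Lemma edist_le_diam (R : realType) n (K : set 'rV[R]_n) x y : K x -> K y ->
  ((edist x y)%:E <= diam K)%E.
Proof. by move=> Kx Ky; apply: ereal_sup_ubound; exists x => //; exists y. Qed.

(* eps_K <= L * min(4 C_n eps_lower, d), stated via squares:
   eps_K^2 <= (L * min(...))^2 in the extended reals. *)
Theorem mainTheorem4 (R : realType) :
  exists c0 C0 : R, forall cstar C : R, c0 <= cstar -> C0 <= C -> 1 < C ->
  exists L : R, 0 < L /\
  forall (n : nat) (K : set 'rV[R]_n) (sigma : R),
    closed K -> convex_set K -> 0 < sigma ->
    let t := (L%:E * Order.min ((4 * Cn C cstar n)%:E * eps_lower cstar sigma K)
                               (diam K))%E in
    (riskK sigma K <= t * t)%E.
Proof.
exists 2, 1 => c C c2 _ C1; exists (risk_cst c).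
have A1 := risk_cst_ge1 c; set A := risk_cst c in A1 *.
have A0 : 0 < A by exact: lt_le_trans A1.
have c1 : 1 < c by apply: lt_le_trans c2; rewrite ltr1n.
have AA : A <= A ^+ 2 by rewrite expr2 ler_peMl// ltW.
split; first exact: A0.
move=> n K s clK cK s0; set t := (_ * _)%E; rewrite /=.
have tt : (0 <= t * t)%E.
  by case: t => [r| |]; rewrite -?EFinM ?lee_fin -?expr2 ?sqr_ge0// /mule /= leey.
apply: ge_ereal_sup => _ [mu Kmu <-].
(* In dimension [0] the error vanishes and [0 <= t * t] suffices; the chain length requires
   [0 < n]. *)
case: (posnP n) => [n0|n0].
  apply: le_trans tt; apply: gauss_exp_le_cst => // v; first exact: sqnorm_ge0.
  rewrite /sqnorm big1// => i _.
  by have := leq_trans (ltn_ord i) (eq_leq n0); rewrite ltn0.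
have [J [J0 _ JL]] := exists_chain_length c1 n0.
have L0 : 0 < 1 + ln (Num.sqrt (2 * pi * n%:R)) / ln c.
  by apply: lt_le_trans JL; rewrite ltr0n.
have Cn0 : 0 < 4 * Cn C c n.
  by rewrite !mulr_gt0 ?powR_gt0// (lt_trans _ C1).
rewrite /t minEle; case: ifP => _.
  have := fun eps => @lse_risk_le_gt_eps_lower R n K mu s c eps clK cK Kmu s0 c1 n0.
  have := eps_lower_ge0 K c s.
  (* If the critical radius is infinite, so is the right-hand side. *)
  case: (eps_lower c s K) => [e| |] // e0 risk; last first.
    by rewrite gt0_muley ?lte_fin// gt0_muley ?lte_fin// mulyy leey.
  rewrite lee_fin in e0; rewrite -!EFinM.
  apply: (@le_trans _ _ (A * (1 + ln (Num.sqrt (2 * pi * n%:R)) / ln c) ^+ 3 * e ^+ 2)%:E).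
    apply: lee_sqr_right => //; first by rewrite mulr_ge0 ?exprn_ge0 ?(ltW L0) ?(ltW A0).
    by move=> h eh; apply: risk; rewrite ?lte_fin// (le_lt_trans e0).
  have L3 : 0 <= (1 + ln (Num.sqrt (2 * pi * n%:R)) / ln c) ^+ 3.
    by rewrite exprn_ge0// ltW.
  have C2 : 1 <= C ^+ 2 by rewrite exprn_ege1// ltW.
  (* By [sqr_Cn] the middle factor is [256 * C ^+ 2] times the cube in the risk bound, so
     [1 <= C ^+ 2] and [A <= A ^+ 2] conclude. *)
  have -> : A * (4 * Cn C c n * e) * (A * (4 * Cn C c n * e)) =
      A ^+ 2 * (16 * Cn C c n ^+ 2) * e ^+ 2.
    by set D := Cn C c n; ring.
  rewrite lee_fin sqr_Cn ?(ltW L0)// ler_wpM2r ?sqr_ge0// ler_pM ?(ltW A0)//.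
  set x := _ ^+ 3 in L3 *.
  by have := ler_wpM2r L3 C2; nra.
(* When the minimum is the diameter, estimator and [mu] both lie in [K], so the error is at most [d]
   pointwise, and [1 <= A]. The point [mu] also rules out the value [-oo]. *)
have := edist_le_diam Kmu Kmu; rewrite edistxx => d0.
have : forall v, ((edist (lse K (mu + v)) mu)%:E <= diam K)%E.
  move=> v; apply: edist_le_diam => //.
  by case: (is_lse_lse (mu + v) clK (ex_intro _ mu Kmu)).
move: d0; case: (diam K) => [d| |] // d0 led; last first.
  by rewrite gt0_muley ?lte_fin// mulyy leey.
rewrite -!EFinM; rewrite lee_fin in d0.
apply: gauss_exp_le_cst => // v; first exact: sqnorm_ge0.
rewrite -expr2 -edist_le ?mulr_ge0 ?(ltW A0)//.
have := led v; rewrite lee_fin => /le_trans; apply.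
by rewrite ler_peMl.
Qed.
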